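(* Let $D$ be a connected checkerboard-colored link diagram with at least one crossing and with associated Tait graph $G$, and let $\sigma$ be a state of $D$. Then $D$ is $\sigma$-adequate with respect to $\sigma$ if and only if the polynomial $\phi_{D}^{\sigma}(t)=\chi_{G|E_{\sigma}}(0,t)\cdot\chi_{G/E_{\sigma}}(t,0)$ is nonzero.
   Context: A link diagram $D\subseteq\mathbb{R}^2$ has a projection graph $\Gamma_D$, obtained by replacing crossings with 4-valent vertices; $D$ is connected if $\Gamma_D$ is connected, and the regions of $D$ are the complementary regions of $\Gamma_D$. $D$ is checkerboard-colored if each region is shaded black or white so that near each crossing two opposite regions are black and the other two opposite regions are white. States. At each crossing one may perform the A-resolution (the smoothing joining the two regions swept out when the over-strand is rotated counterclockwise toward the under-strand) or the B-resolution (the other smoothing). A state $\sigma$ of $D$ is a choice of A- or B-resolution at each crossing. Resolving all crossings according to $\sigma$ gives the state graph $H_\sigma$, consisting of disjoint state circles together with one state segment per crossing, recording the location and type of the resolution. $D$ is $\sigma$-adequate with respect to $\sigma$ if no state segment of $H_\sigma$ connects a state circle to itself. Tait graph. The Tait graph $G$ of a checkerboard-colored diagram $D$ is the plane multigraph with one vertex per black region and one edge per crossing, joining the vertices of the two black regions meeting at that crossing (a loop if the same black region meets the crossing twice). Its edges are signed: an edge is $+$ if the A-resolution of its crossing locally joins the two black regions (so the B-resolution separates them), and $-$ if the B-resolution locally joins the two black regions (so the A-resolution separates them). The set $E_\sigma\subseteq E(G)$ is the union of the $+$ edges whose crossings are A-resolved by $\sigma$ and the $-$ edges whose crossings are B-resolved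 by $\sigma$. For $H\subseteq E(G)$, $G|H$ is the spanning subgraph with all vertices of $G$ and edge set $H$, and $G/H$ is obtained from $G$ by contracting the edges of $H$ (contracting a loop means deleting it). Tutte polynomial. $\chi_G(x,y)$ denotes the Tutte polynomial of a multigraph $G$: $\chi_G=1$ if $G$ has no edges, $\chi_G=x\,\chi_{G/e}$ if $e$ is a bridge, $\chi_G=y\,\chi_{G-e}$ if $e$ is a loop, and $\chi_G=\chi_{G/e}+\chi_{G-e}$ if $e$ is neither; it is multiplicative over disjoint unions and over blocks. *)

(* Defs.v *)
From HB Require Import structures.
From mathcomp Require Import all_boot all_order all_algebra.

Set Implicit Arguments.
Unset Strict Implicit.
Unset Printing Implicit Defensive.

Import GRing.Theory.
Local Open Scope ring_scope.

(* Only used with relations [e] whose [connect e] is symmetric. *)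
Definition component (T : finType) (e : rel T) : finType :=
  {A : {set T} | A \in [set [set y | connect e x y] | x : T]}.

Definition component_of (T : finType) (e : rel T) (x : T) : component e :=
  exist _ [set y | connect e x y]
    (imset_f (fun x => [set y | connect e x y]) (isT : x \in T)).

(* The order of the two ends of an edge carries no information. *)
Record mgraph := MGraph {
  vert : finType;
  edge : finType;
  ends : edge -> vert * vert }.

Section Multigraph.
Variable G : mgraph.

Definition adj : rel (vert G) := fun u v =>
  [exists e : edge G, (ends e == (u, v)) || (ends e == (v, u))].

(* G|H *)
Definition spanning (H : {set edge G}) : mgraph :=
  @MGraph (vert G) {e : edge G | e \in H} (fun e => ends (val e)).

Definition delete (e : edge G) : mgraph := spanning (~: [set e]).

Definition is_loop (e : edge G) : bool := (ends e).1 == (ends e).2.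

End Multigraph.

Definition is_bridge (G : mgraph) (e : edge G) : bool :=
  ~~ connect (@adj (delete e)) (ends e).1 (ends e).2.

(* G/H: the vertices are the connected components of G|H, and the edges of H
   (in particular its loops) disappear. *)
Definition contract (G : mgraph) (H : {set edge G}) : mgraph :=
  @MGraph (component (@adj (spanning H))) {e : edge G | e \in ~: H}
    (fun e => (component_of (@adj (spanning H)) (ends (val e)).1,
               component_of (@adj (spanning H)) (ends (val e)).2)).

(* Elements of Z[x][y]: x is the inner variable ['X%:P], y the outer one ['X].
   The recursion is run along one choice of edges; that the result does not
   depend on this choice is the classical theorem of Tutte. *)
Fixpoint tutte_rec (n : nat) (G : mgraph) : {poly {poly int}} :=
  if n isn't m.+1 then 1 else
  if [pick e : edge G] is Some e then
    if is_bridge e then 'X%:P * tutte_rec m (contract [set e])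
    else if is_loop e then 'X * tutte_rec m (delete e)
    else tutte_rec m (contract [set e]) + tutte_rec m (delete e)
  else 1.

Definition tutte (G : mgraph) : {poly {poly int}} := tutte_rec #|edge G| G.

(* chi(a, b) for polynomials a and b in one variable t *)
Definition eval2 (chi : {poly {poly int}}) (a b : {poly int}) : {poly int} :=
  (map_poly (comp_poly a) chi).[b].

(* A diagram is recorded by the combinatorial map of its projection, as in a
   PD code: the half-edges at a crossing [c] are the pairs [(c, i)],
   [i = 0, 1, 2, 3] in counterclockwise order, the under-strand being made of
   [(c, 0)] and [(c, 2)], the over-strand of [(c, 1)] and [(c, 3)]; [glue]
   exchanges the two half-edges of each edge of the projection.
   The half-edge [(c, i)] also names the corner of [c] between [(c, i)] and
   [(c, i + 1)].
   Crossingless circles have no half-edge, hence are not represented; they do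
   not occur in a connected diagram with a crossing. *)
Section Projection.
Variables (C : finType) (glue : C * 'Z_4 -> C * 'Z_4).

(* The next corner of the same region: leave [c] along [(c, i)] with the corner
   [(c, i)] on the left; if the edge ends at [(c', j)], the corner on the left
   on arrival is the one between [(c', j - 1)] and [(c', j)]. *)
Definition next_corner (d : C * 'Z_4) : C * 'Z_4 :=
  ((glue d).1, (glue d).2 - 1).

Definition crossing_adj : rel C :=
  fun c c' => [exists i, exists j, glue (c, i) == (c', j)].

(* Euler's formula V - E + F = 2k, where k is the number of components and F
   counts the faces of the components separately: every component has genus 0 *)
Definition euler_planar : Prop :=
  (#|C| + #|component (frel next_corner)|
   = #|component (frel glue)| + 2 * #|component crossing_adj|)%N.

End Projection.

Record link_diagram := LinkDiagram {
  crossing : finType;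
  glue : crossing * 'Z_4 -> crossing * 'Z_4;
  glueK : involutive glue;
  glue_neq : forall d, glue d != d;
  planar : euler_planar glue }.

Definition connected (D : link_diagram) : Prop :=
  forall c c' : crossing D, connect (crossing_adj (@glue D)) c c'.

(* For a connected diagram, the complementary regions of the projection
   correspond to the boundary walks around them. *)
Definition region (D : link_diagram) : finType :=
  component (frel (next_corner (@glue D))).

Definition region_at (D : link_diagram) (d : crossing D * 'Z_4) : region D :=
  component_of (frel (next_corner (@glue D))) d.

Record checkerboard (D : link_diagram) := Checkerboard {
  black :> region D -> bool;
  blackP : forall (c : crossing D) (i : 'Z_4),
    black (region_at (c, i + 1)) = ~~ black (region_at (c, i)) }.

Inductive resolution := Ares | Bres.

(* The resolution [r] joins the corners [joined r] and [joined r + 2].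
   Turned counterclockwise, the over-strand sweeps the corners between
   half-edges 1 and 2 and between half-edges 3 and 0. *)
Definition joined (r : resolution) : 'Z_4 := if r is Ares then 1 else 0.

(* The half-edge linked to half-edge [i] by an arc of the smoothing: the arcs
   cut off the two corners that are not joined, so they are 0-1, 2-3 for A and
   1-2, 3-0 for B. *)
Definition smoothing_arc (r : resolution) (i : 'Z_4) : 'Z_4 :=
  if odd (val i + val (joined r))%N then i + 1 else i - 1.

Definition state (D : link_diagram) := crossing D -> resolution.

Definition circle_rel (D : link_diagram) (s : state D) :
    rel (crossing D * 'Z_4) :=
  fun d d' => (d' == glue d) || (d' == (d.1, smoothing_arc (s d.1) d.2)).

(* Vertices are the state circles and edges the state segments. Half-edges 0
   and 2 of a crossing lie on the two different arcs of either smoothing. *)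
Definition state_graph (D : link_diagram) (s : state D) : mgraph :=
  @MGraph (component (circle_rel s)) (crossing D)
    (fun c => (component_of (circle_rel s) (c, 0),
               component_of (circle_rel s) (c, 2))).

Definition adequate (D : link_diagram) (s : state D) : Prop :=
  forall c : edge (state_graph s), ~~ is_loop c.

Section Tait.
Variables (D : link_diagram) (k : checkerboard D).

(* The black corners of [c] are [black_corner c] and [black_corner c + 2]. *)
Definition black_corner (c : crossing D) : 'Z_4 :=
  if k (region_at (c, 0)) then 0 else 1.

Lemma black_corner1 c : k (region_at (c, black_corner c)).
Proof.
rewrite /black_corner; case: ifPn => // h.
by rewrite -[1]add0r blackP.
Qed.

Lemma black_corner2 c : k (region_at (c, black_corner c + 2)).
Proof.
rewrite (_ : 2 = 1 + 1) // addrA !blackP negbK.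
exact: black_corner1.
Qed.

Definition black_region : finType := {R : region D | k R}.

Definition tait_ends (c : crossing D) : black_region * black_region :=
  (exist (fun R => k R) (region_at (c, black_corner c)) (black_corner1 c),
   exist (fun R => k R) (region_at (c, black_corner c + 2)) (black_corner2 c)).

(* The plane embedding is dropped: Tutte polynomials only see the multigraph. *)
Definition tait_graph : mgraph := MGraph tait_ends.

Definition joins_black (r : resolution) (c : crossing D) : bool :=
  k (region_at (c, joined r)).

Definition positive_edge (c : edge tait_graph) : bool := joins_black Ares c.
Definition negative_edge (c : edge tait_graph) : bool := joins_black Bres c.

Definition E_state (s : state D) : {set edge tait_graph} :=
  [set c | if s c is Ares then positive_edge c else negative_edge c].

Definition phi (s : state D) : {poly int} :=
  eval2 (tutte (spanning (E_state s))) 0 'X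
  * eval2 (tutte (contract (E_state s))) 'X 0.

End Tait.

(* Main.v *)
Require Import Defs.
From mathcomp Require Import all_boot all_order all_algebra all_fingroup.
From mathcomp Require Import zify.

Set Implicit Arguments.
Unset Strict Implicit.
Unset Printing Implicit Defensive.

Import Order.TTheory GRing.Theory Num.Theory.
Local Open Scope ring_scope.

(** The polynomial [phi] is a product over the integral domain Z[t], so both
    factors have to be analysed. Evaluating a Tutte polynomial at [x = 0] turns
    the bridge rule into multiplication by 0, and the coefficients produced by
    the other rules are nonnegative and cannot cancel: [chi(0, t)] is nonzero
    exactly when the graph has no bridge ([tutte_0X_neq0]). Dually [chi(t, 0)]
    is nonzero exactly when there is no loop ([tutte_X0_neq0]). Hence [phi] is
    nonzero if and only if no edge of [E_sigma] is a bridge of [G|E_sigma] and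
    no edge outside [E_sigma] has both ends in one component of [G|E_sigma].

    It remains to compare this with the state circles, which are the boundary
    curves of a ribbon neighbourhood of [G|E_sigma] in the sphere. The cyclic
    order of the edges around the black regions is a permutation [rho] of the
    ends of edges, and for a set [H] of edges the boundary curves of the ribbon
    graph of [G|H] are the cycles of the product [walk H] of [rho] with the
    transpositions exchanging the two ends of each edge of [H]. Multiplying by
    one transposition splits or merges a cycle, so adding an edge to [H] changes
    the number of curves by 1, upwards when the band of the new edge is
    attached to a single curve. Comparing with the number of components shows
    that the genus given by Euler's formula does not decrease when [H] grows
    ([genus2_setU1]). It is at least 0 for [H] empty and, the diagram being
    planar and connected, at most 0 when [H] consists of all edges; so it is
    always 0, and each step of the comparison is tight. This says that the
    segment of an edge outside [H] joins a curve to itself if and only if the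
    ends of the edge are already connected in [G|H] ([same_face_notin]), and the
    segment of an edge of [H] does so if and only if this edge is a bridge of
    [G|H] ([same_face_in]). *)

(** * Components of a relation *)

Lemma card_imset_le (T S S' : finType) (f : T -> S) (g : T -> S') :
  (forall x y, g x = g y -> f x = f y) -> (#|f @: T| <= #|g @: T|)%N.
Proof.
move=> gf; pose h y := omap f [pick x | g x == y].
apply: leq_trans (leq_imset_card h _).
have Some_inj : injective (@Some S) by move=> x y [].
rewrite -(card_imset _ Some_inj); apply/subset_leq_card/subsetP.
move=> _ /imsetP[_ /imsetP[x _ ->] ->]; apply/imsetP; exists (g x).
  exact: imset_f.
by rewrite /h; case: pickP => [y /eqP/gf/= ->|/(_ x)] //; rewrite eqxx.
Qed.

Section Components.
Variables (T : finType) (e : rel T).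

Lemma component_ofP (A : component e) : exists x, A == component_of e x.
Proof.
case: A => A mA; have /imsetP[x _ defA] := mA.
by exists x; apply/eqP/val_inj.
Qed.

Hypothesis sym_e : connect_sym e.

Lemma eq_component_of x y :
  (component_of e x == component_of e y) = connect e x y.
Proof.
apply/eqP/idP => [/(congr1 val)/= /setP/(_ y)|exy].
  by rewrite !inE connect0.
by apply/val_inj/setP => z /=; rewrite !inE (same_connect sym_e exy).
Qed.

(** Every bound below on a number of components comes from exhibiting a
    function that tells the components apart. *)
Lemma card_component_le (S : finType) (A : {set S}) (f : T -> S) :
    (forall x, f x \in A) -> (forall x y, f x = f y -> connect e x y) ->
  (#|component e| <= #|A|)%N.
Proof.
move=> fA f_sep; apply: (@leq_trans #|f @: T|); last first.
  by apply/subset_leq_card/subsetP => _ /imsetP[x _ ->].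
apply: (@leq_trans #|component_of e @: T|); last first.
  apply: card_imset_le => x y /f_sep; rewrite -eq_component_of.
  exact: eqP.
rewrite -cardsT; apply/subset_leq_card/subsetP => A' _.
by have /eqP-> := xchooseP (component_ofP A'); exact: imset_f.
Qed.

End Components.

(** * Connectivity in multigraphs *)

Section Connectivity.
Variable G : mgraph.
Implicit Types (H K : {set edge G}) (e : edge G) (u v : vert G).

(** Reachability in [G|H]; bridges and loops of the minors of [G] are all
    expressed through it, as relations on the edges of [G] itself. *)
Definition linked H : rel (vert G) := connect (@adj (spanning H)).

Lemma adj_spanningP H u v :
  reflect (exists2 e, e \in H & ends e = (u, v) \/ ends e = (v, u))
          (@adj (spanning H) u v).
Proof.
apply: (iffP existsP) => [[[e eH] /= /orP[]/eqP he]|[e eH he]].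
- by exists e => //; left.
- by exists e => //; right.
by exists (exist _ e eH) => /=; case: he => ->; rewrite eqxx ?orbT.
Qed.

Lemma adj_sym : symmetric (@adj G).
Proof. by move=> u v; apply: eq_existsb => e; rewrite orbC. Qed.

Lemma adj_connect_sym : connect_sym (@adj G).
Proof. exact/sym_connect_sym/adj_sym. Qed.

End Connectivity.

Section Linked.
Variable G : mgraph.
Implicit Types (H K : {set edge G}) (e : edge G) (u v : vert G).

Lemma linked_sym H : symmetric (linked H).
Proof. by move=> u v; apply: (@adj_connect_sym (spanning H)). Qed.

Lemma linked_trans H : transitive (linked H).
Proof. exact: connect_trans. Qed.

Lemma linked_ends H e : e \in H -> linked H (ends e).1 (ends e).2.
Proof.
move=> eH; apply/connect1/adj_spanningP; exists e => //; left.
exact: surjective_pairing.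
Qed.

Lemma linked_sub H K :
    (forall e, e \in H -> linked K (ends e).1 (ends e).2) ->
  subrel (linked H) (linked K).
Proof.
move=> HK; apply: connect_sub => u v /adj_spanningP[e /HK eK [] he].
  by move: eK; rewrite he.
by rewrite -/(linked K u v) linked_sym; move: eK; rewrite he.
Qed.

Lemma linkedS H K : H \subset K -> subrel (linked H) (linked K).
Proof. by move=> /subsetP HK; apply: linked_sub => e /HK/linked_ends. Qed.

Lemma linked_set0 u v : linked set0 u v -> u = v.
Proof.
case/connectP => [[|w p]] /=; first by move=> _ ->.
by case/andP=> /adj_spanningP[e]; rewrite inE.
Qed.

(** A path in [G|(H + e)] may be assumed to use [e] at most once. *)
Lemma linked_setU1 H e u v : let: (a, b) := ends e in
  linked (e |: H) u v ->
  [\/ linked H u v, linked H u a && linked H b v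
    | linked H u b && linked H a v].
Proof.
case def_e: (ends e) => [a b] /connectP[p]; elim: p u => [|w p IHp] u /=.
  by move=> _ ->; constructor 1; exact: connect0.
case/andP=> uw wp /(IHp _ wp){IHp wp} IH; move: IH.
have {uw} [uw|[-> ->]|[-> ->]] :
    [\/ linked H u w, u = a /\ w = b | u = b /\ w = a].
- case/adj_spanningP: uw => f /setU1P[-> | fH]; last first.
    move=> hf; constructor 1; apply/connect1/adj_spanningP.
    by exists f.
  by rewrite def_e => -[[-> ->]|[-> ->]]; [constructor 2 | constructor 3].
- case=> [wv|/andP[wa bv]|/andP[wb av]].
  + by constructor 1; exact: linked_trans wv.
  + by constructor 2; rewrite bv (linked_trans uw wa).
  + by constructor 3; rewrite av (linked_trans uw wb).
- case=> [bv|/andP[_ bv]|/andP[_ av]]; last by constructor 1.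
  + by constructor 2; rewrite bv [linked _ _ _]connect0.
  + by constructor 2; rewrite bv [linked _ _ _]connect0.
- case=> [av|/andP[_ bv]|/andP[_ av]]; first 1 last.
  + by constructor 1.
  + by constructor 3; rewrite av [linked _ _ _]connect0.
  + by constructor 3; rewrite av [linked _ _ _]connect0.
Qed.

Lemma linked_setU1_id H e :
    linked H (ends e).1 (ends e).2 -> linked (e |: H) =2 linked H.
Proof.
move=> he u v; apply/idP/idP; last exact/linkedS/subsetUr.
by apply: linked_sub => f /setU1P[-> //|]; exact: linked_ends.
Qed.

Lemma is_bridgeE e : is_bridge e = ~~ linked (~: [set e]) (ends e).1 (ends e).2.
Proof. by []. Qed.

Lemma is_bridge_not_loop e : is_bridge e -> ~~ is_loop e.
Proof. by apply: contra => /eqP he; rewrite he connect0. Qed.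

End Linked.

Section Minors.
Variable G : mgraph.
Implicit Types (H K : {set edge G}) (e : edge G) (u v : vert G).

Lemma linked_spanning H (K : {set edge (spanning H)}) :
  @linked (spanning H) K =2 linked (val @: K).
Proof.
apply: eq_connect => u v; apply/adj_spanningP/adj_spanningP.
  by case=> f fK he; exists (val f) => //; exact: imset_f.
by case=> _ /imsetP[f fK ->] he; exists f.
Qed.

Lemma val_setC1_spanning H (e : edge (spanning H)) :
  val @: (~: [set e]) = H :\ val e.
Proof.
apply/setP => f; apply/imsetP/setD1P => [[g ge ->]|[fe fH]].
  by split; [move: ge; rewrite !inE (inj_eq val_inj) | exact: (valP g)].
exists (exist _ f fH) => //.
by rewrite !inE -(inj_eq val_inj).
Qed.

Lemma is_bridge_spanning H (e : edge (spanning H)) :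
  is_bridge e = ~~ linked (H :\ val e) (ends (val e)).1 (ends (val e)).2.
Proof. by rewrite is_bridgeE linked_spanning val_setC1_spanning. Qed.

Lemma eq_contracted_vertex H u v :
  (component_of (@adj (spanning H)) u == component_of (@adj (spanning H)) v)
  = linked H u v.
Proof. exact/eq_component_of/adj_connect_sym. Qed.

Lemma is_loop_contract H (e : edge (contract H)) :
  is_loop e = linked H (ends (val e)).1 (ends (val e)).2.
Proof. exact: eq_contracted_vertex. Qed.

(** Paths of [G/H] lift to paths of [G] that may run inside [H]. *)
Lemma linked_contract H (K : {set edge (contract H)}) u v :
  @linked (contract H) K (component_of _ u) (component_of _ v)
  = linked (H :|: val @: K) u v.
Proof.
set L := H :|: _.
have HL : subrel (linked H) (linked L) by apply/linkedS/subsetUl.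
have cL x y : component_of _ x = component_of _ y :> vert (contract H) ->
    linked L x y.
  by move=> xy; apply: HL; rewrite -eq_contracted_vertex; exact/eqP.
apply/idP/idP.
  case/connectP => p; elim: p u => [|w p IHp] u /=; first by move=> _ /esym/cL.
  have /eqP-> := xchooseP (component_ofP w).
  set x := xchoose _ => /andP[ux xp] /(IHp _ xp).
  apply: linked_trans; case/adj_spanningP: ux => f fK /= hf.
  have /linked_ends fL : val f \in L by rewrite inE imset_f ?orbT.
  case: hf => hf; have /cL h1 := congr1 fst hf; have /cL h2 := congr1 snd hf;
    last rewrite linked_sym in fL.
    by apply: linked_trans h2; rewrite linked_sym in h1; apply: linked_trans fL.
  by apply: linked_trans h1; rewrite linked_sym in h2; apply: linked_trans fL.
case/connectP => p; elim: p u => [|w p IHp] u /=.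
  by move=> _ ->; exact: connect0.
case/andP=> uw wp /(IHp _ wp); apply: connect_trans.
case/adj_spanningP: uw => f /setUP[fH|/imsetP[g gK ->]] hf.
  apply/eq_connect0/eqP; rewrite eq_contracted_vertex.
  have := linked_ends fH; case: hf => -> //=.
  by rewrite linked_sym.
apply/connect1/adj_spanningP; exists g => //=.
by case: hf => -> /=; [left | right].
Qed.

Lemma is_bridge_contract H (e : edge (contract H)) :
  is_bridge e = ~~ linked (~: [set val e]) (ends (val e)).1 (ends (val e)).2.
Proof.
rewrite is_bridgeE linked_contract; congr (~~ linked _ _ _).
rewrite (@val_setC1_spanning (~: H) e); apply/setP => f; rewrite !inE.
have := valP e; rewrite inE; case: (f =P val e) => [->|_] /=.
  by move/negbTE->.
by rewrite orbN.
Qed.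

End Minors.
(** * Bridges, loops and the Tutte polynomial *)

Definition bridgeless (G : mgraph) : Prop := forall e : edge G, ~~ is_bridge e.
Definition loopless (G : mgraph) : Prop := forall e : edge G, ~~ is_loop e.

Section DeletionContraction.
Variables (G : mgraph) (e : edge G).

Lemma other_edge (f : edge G) : f != e -> f \in ~: [set e].
Proof. by rewrite !inE. Qed.

Lemma is_bridge_delete (f : edge (delete e)) :
  is_bridge f
  = ~~ linked (~: [set e] :\ val f) (ends (val f)).1 (ends (val f)).2.
Proof. exact: is_bridge_spanning. Qed.

(** Contracting [e] does not affect whether another edge is a bridge, since
    paths avoiding that edge are free to use [e]. *)
Lemma bridgeless_contract :
  ~~ is_bridge e -> bridgeless (contract [set e]) <-> bridgeless G.
Proof.
move=> e_nb; split=> G_nb f; last by rewrite is_bridge_contract -is_bridgeE.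
have [-> //|/other_edge fe] := eqVneq f e.
by have := G_nb (exist _ f fe); rewrite is_bridge_contract -is_bridgeE.
Qed.

Lemma bridgeless_delete :
  ~~ is_bridge e -> bridgeless (delete e) -> bridgeless G.
Proof.
move=> e_nb Ge_nb f; have [-> //|/other_edge fe] := eqVneq f e.
have := Ge_nb (exist _ f fe); rewrite is_bridge_delete is_bridgeE !negbK /=.
by apply: linkedS; apply/subsetP => g; rewrite !inE => /andP[].
Qed.

Lemma bridgeless_delete_loop :
  is_loop e -> bridgeless (delete e) <-> bridgeless G.
Proof.
move=> e_loop; split.
  by apply: bridgeless_delete; apply/negP => /is_bridge_not_loop/negP.
move=> G_nb f; have := G_nb (val f); rewrite is_bridge_delete is_bridgeE !negbK.
apply: linked_sub => g; rewrite !inE => gf.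
have [->|ge] := eqVneq g e.
  by rewrite (eqP e_loop) [linked _ _ _]connect0.
by apply: linked_ends; rewrite !inE gf.
Qed.

Lemma loopless_delete : ~~ is_loop e -> loopless (delete e) <-> loopless G.
Proof.
move=> e_nl; split=> G_nl f; last exact: G_nl (val f).
have [-> //|/other_edge fe] := eqVneq f e.
exact: G_nl (exist _ f fe).
Qed.

Lemma loopless_of_contract :
  ~~ is_loop e -> loopless (contract [set e]) -> loopless G.
Proof.
move=> e_nl Ge_nl f; have [-> //|/other_edge fe] := eqVneq f e.
have := Ge_nl (exist _ f fe); rewrite is_loop_contract.
apply: contra => /eqP /= ->.
exact: connect0.
Qed.

(** An edge that becomes a loop in [G/e] is a loop of [G] or parallel to [e],
    and the latter is excluded for a bridge [e]. *)
Lemma loopless_contract_bridge :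
  is_bridge e -> loopless (contract [set e]) <-> loopless G.
Proof.
move=> e_br; split; first exact/loopless_of_contract/is_bridge_not_loop.
move=> G_nl f; rewrite is_loop_contract; apply/negP.
have := linked_ends (valP f); move: (G_nl (val f)); rewrite /is_loop.
case: (ends (val f)) => u v /= uv fuv; rewrite -[[set e]]setU0.
have := @linked_setU1 G set0 e u v; case def_e: (ends e) => [a b] H.
move: e_br; rewrite is_bridgeE def_e /= => /negP nab; case/H.
- by move=> /linked_set0 euv; rewrite euv eqxx in uv.
- by case/andP=> /linked_set0 ua /linked_set0 bv; apply: nab; rewrite -ua bv.
- case/andP=> /linked_set0 ub /linked_set0 av; apply: nab.
  by rewrite linked_sym -ub av.
Qed.

Lemma card_edge_delete : #|edge (delete e)| = #|edge G|.-1.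
Proof. by rewrite card_sig -(cardC1 e); apply: eq_card => f; rewrite !inE. Qed.

Lemma card_edge_contract : #|edge (contract [set e])| = #|edge G|.-1.
Proof. exact: card_edge_delete. Qed.

End DeletionContraction.

Section Evaluation.
Variables a b : {poly int}.

Lemma eval2D p q : eval2 (p + q) a b = eval2 p a b + eval2 q a b.
Proof. by rewrite /eval2 rmorphD hornerD. Qed.

Lemma eval2M p q : eval2 (p * q) a b = eval2 p a b * eval2 q a b.
Proof. by rewrite /eval2 rmorphM hornerM. Qed.

Lemma eval2_1 : eval2 1 a b = 1.
Proof. by rewrite /eval2 rmorph1 hornerC. Qed.

Lemma eval2_X : eval2 'X a b = b.
Proof. by rewrite /eval2 map_polyX hornerX. Qed.

Lemma eval2_XC : eval2 'X%:P a b = a.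
Proof. by rewrite /eval2 map_polyC hornerC /= comp_polyX. Qed.

Definition eval2E := (eval2D, eval2M, eval2_1, eval2_X, eval2_XC).

End Evaluation.

Definition nonneg_coef (p : {poly int}) := forall i, 0 <= p`_i.

Lemma nonneg_coefD p q : nonneg_coef p -> nonneg_coef q -> nonneg_coef (p + q).
Proof. by move=> p0 q0 i; rewrite coefD addr_ge0. Qed.

Lemma nonneg_coefM p q : nonneg_coef p -> nonneg_coef q -> nonneg_coef (p * q).
Proof.
by move=> p0 q0 i; rewrite coefM; apply: sumr_ge0 => j _; rewrite mulr_ge0.
Qed.

Lemma nonneg_coef0 : nonneg_coef 0.
Proof. by move=> i; rewrite coef0. Qed.

Lemma nonneg_coef1 : nonneg_coef 1.
Proof. by move=> i; rewrite coef1 ler0n. Qed.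

Lemma nonneg_coefX : nonneg_coef 'X.
Proof. by move=> i; rewrite coefX ler0n. Qed.

Lemma nonneg_coef_add_neq0 (p q : {poly int}) :
  nonneg_coef p -> nonneg_coef q -> (p + q != 0) = (p != 0) || (q != 0).
Proof.
move=> p0 q0; rewrite -negb_and; congr negb.
apply/eqP/andP => [pq0|[/eqP-> /eqP->]]; last by rewrite addr0.
have pq_i i : (p`_i == 0) && (q`_i == 0).
  by rewrite -paddr_eq0 ?p0 ?q0 // -coefD pq0 coef0.
by split; apply/eqP/polyP => i; rewrite coef0;
  case/andP: (pq_i i) => /eqP ? /eqP.
Qed.

Lemma nonneg_coef_tutte n (G : mgraph) (a b : {poly int}) :
  nonneg_coef a -> nonneg_coef b -> nonneg_coef (eval2 (tutte_rec n G) a b).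
Proof.
move=> a0 b0; have c1 := nonneg_coef1; elim: n G => [|n IHn] G /=.
  by rewrite eval2E.
case: pickP => [e _|_]; last by rewrite eval2E.
by do 2?case: ifP => _; rewrite !eval2E;
  do ?[exact: nonneg_coefM | exact: nonneg_coefD].
Qed.

(** If the recursion runs along a bridge, the value at [x = 0] vanishes. In the
    other cases a bridgeless graph has a bridgeless contraction (or deletion,
    for a loop), while a bridge of [G] survives in both minors; a sum of
    polynomials with nonnegative coefficients vanishes only if both terms do. *)
Lemma tutte_0X_neq0 (G : mgraph) :
  (eval2 (tutte G) 0 'X != 0) <-> bridgeless G.
Proof.
rewrite /tutte; move: {2}#|edge G| (erefl #|edge G|) => n.
elim: n G => [|n IHn] G cardG; rewrite cardG /=.
  rewrite eval2E oner_eq0; split=> // _ e.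
  by have := card0_eq cardG e.
case: pickP => [e _|noe]; last by rewrite (eq_card0 noe) in cardG.
have IHd := IHn (delete e); have IHc := IHn (contract [set e]).
rewrite card_edge_delete cardG in IHd; rewrite card_edge_contract cardG in IHc.
case: ifPn => e_br.
  by rewrite !eval2E mul0r eqxx; split=> // /(_ e); rewrite e_br.
case: ifPn => e_loop.
  rewrite !eval2E mulf_eq0 polyX_eq0 /=; apply: iff_trans (IHd erefl) _.
  exact: bridgeless_delete_loop.
have nonneg H := nonneg_coef_tutte n H nonneg_coef0 nonneg_coefX.
rewrite eval2D nonneg_coef_add_neq0 //.
split; last by move/(bridgeless_contract e_br)/(IHc erefl) => ->.
case/orP => [/(IHc erefl)|/(IHd erefl)]; last exact: bridgeless_delete.
by move/(bridgeless_contract e_br).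
Qed.

(** The dual argument: deletion and the contraction of a bridge keep a graph
    loopless, and a loop other than the current edge survives in both minors. *)
Lemma tutte_X0_neq0 (G : mgraph) :
  (eval2 (tutte G) 'X 0 != 0) <-> loopless G.
Proof.
rewrite /tutte; move: {2}#|edge G| (erefl #|edge G|) => n.
elim: n G => [|n IHn] G cardG; rewrite cardG /=.
  rewrite eval2E oner_eq0; split=> // _ e.
  by have := card0_eq cardG e.
case: pickP => [e _|noe]; last by rewrite (eq_card0 noe) in cardG.
have IHd := IHn (delete e); have IHc := IHn (contract [set e]).
rewrite card_edge_delete cardG in IHd; rewrite card_edge_contract cardG in IHc.
case: ifPn => e_br.
  rewrite !eval2E mulf_eq0 polyX_eq0 /=; apply: iff_trans (IHc erefl) _.
  exact: loopless_contract_bridge.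
case: ifPn => e_loop.
  by rewrite !eval2E mul0r eqxx; split=> // /(_ e); rewrite e_loop.
have nonneg H := nonneg_coef_tutte n H nonneg_coefX nonneg_coef0.
rewrite eval2D nonneg_coef_add_neq0 //.
split; last by move/(loopless_delete e_loop)/(IHd erefl) => ->; rewrite orbT.
case/orP => [/(IHc erefl)|/(IHd erefl)]; first exact: loopless_of_contract.
by move/(loopless_delete e_loop).
Qed.

(** * Rotation systems *)

Lemma porbit_connect (T X : finType) (e : rel T) (s : {perm X}) (f : X -> T) :
    (forall x, connect e (f x) (f (s x))) ->
  forall x y, y \in porbit s x -> connect e (f x) (f y).
Proof.
move=> fs x _ /porbitP[n ->]; elim: n => [|n IHn].
  by rewrite expg0 perm1 connect0.
by rewrite expgSr permM; exact: connect_trans IHn (fs _).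
Qed.

Section RotationSystem.
Variables (G : mgraph) (rho : {perm (edge G * bool)}).
Implicit Types (H K : {set edge G}) (e : edge G) (x y : edge G * bool).

Definition endpoint x : vert G := if x.2 then (ends x.1).2 else (ends x.1).1.

Hypothesis endpointP :
  forall x y, reflect (endpoint x = endpoint y) (y \in porbit rho x).

Definition flip_fun H x := (x.1, x.2 (+) (x.1 \in H)).

Lemma flip_funK H : involutive (flip_fun H).
Proof. by case=> e b; rewrite /flip_fun /= addbK. Qed.

Definition flip H : {perm edge G * bool} := perm (inv_inj (flip_funK H)).

(** The cycles of this permutation are the boundary curves of the ribbon graph
    of [G|H]: one crosses to the other end of an edge precisely when it is
    in [H], then moves on to the next edge around the vertex. *)
Definition walk H : {perm edge G * bool} := (flip H * rho)%g.

Lemma walkE H x : walk H x = rho (flip_fun H x).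
Proof. by rewrite permM permE. Qed.

Lemma walk_set0 : walk set0 = rho.
Proof.
by apply/permP => -[e b]; rewrite walkE /flip_fun /= inE addbF.
Qed.

Lemma walk_setU1 H e :
  e \notin H -> walk (e |: H) = (tperm (e, false) (e, true) * walk H)%g.
Proof.
move=> /negbTE eH; apply/permP => -[f b].
rewrite [RHS]permM [LHS]walkE [RHS]walkE.
case: tpermP => [[-> ->]|[-> ->]|].
- by rewrite /flip_fun /= eH !inE eqxx.
- by rewrite /flip_fun /= eH !inE eqxx.
rewrite /flip_fun /= !inE; have [->|//] := eqVneq f e.
by case: b.
Qed.

Definition faces H := #|porbits (walk H)|.
Definition comps H := #|component (@adj (spanning H))|.

(** The points [(e, false)] and [(e, true)] of the curves lie on the two sides
    of the band of [e] if [e] is in [H], and where this band would be attached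
    otherwise; in both cases the state segment of [e] joins them. *)
Definition same_face H e := (e, false) \in porbit (walk H) (e, true).

(** Multiplication by a transposition splits a cycle containing both points
    and merges the two cycles otherwise. *)
Lemma faces_setU1 H e : e \notin H ->
  (faces (e |: H) + (~~ same_face H e).*2 = faces H + 1)%N.
Proof.
move=> eH; have := porbits_mul_tperm (walk H) (e, false) (e, true).
by rewrite /= -walk_setU1 // xpair_eqE andbF => ->.
Qed.

(** The transposition of the two ends of [e] also leads back from [e |: H] to
    [H], where it undoes the splitting or merging. *)
Lemma same_face_setU1 H e :
  e \notin H -> same_face (e |: H) e = ~~ same_face H e.
Proof.
move=> eH; have /= := porbits_mul_tperm (walk (e |: H)) (e, false) (e, true).
have -> : (tperm (e, false) (e, true) * walk (e |: H) = walk H)%g.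
  by rewrite walk_setU1 // mulgA tperm2 mul1g.
have := faces_setU1 eH; rewrite /= -/(faces _) -/(faces _) -/(same_face _ _).
by rewrite xpair_eqE andbF /=; case: same_face; case: same_face => /=; lia.
Qed.

(** A boundary curve stays in one component of [G|H]. *)
Lemma linked_walk H x y :
  y \in porbit (walk H) x -> linked H (endpoint x) (endpoint y).
Proof.
apply: porbit_connect => z.
rewrite walkE.
have <- : endpoint (flip_fun H z) = endpoint (rho (flip_fun H z)).
  by apply/endpointP; have := mem_porbit rho 1 (flip_fun H z).
case: z => e b; rewrite /flip_fun /endpoint /=.
case eH: (e \in H); last by rewrite addbF connect0.
by case: b => /=; [rewrite -/(linked _ _ _) linked_sym|]; exact: linked_ends.
Qed.

(** Components not meeting the second end of [e] remain distinct when [e] is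
    added. *)
Lemma comps_setU1 H e : (comps H <= (comps (e |: H)).+1)%N.
Proof.
pose c u := if linked H u (ends e).2 then None
            else Some (component_of (@adj (spanning (e |: H))) u).
rewrite /comps -card_option -[X in (_ <= X)%N]cardsT.
apply: (@card_component_le _ _ (@adj_connect_sym (spanning H)) _ _ c) => // u v.
rewrite /c; case: ifPn => ue; case: ifPn => ve //.
  by move=> _; rewrite linked_sym in ve; exact: linked_trans ve.
move/(congr1 (odflt (component_of _ u)))/eqP; rewrite /= eq_contracted_vertex.
move: ue ve; have := @linked_setU1 G H e u v; case: (ends e) => a b /= Huv.
move=> /negbTE ub /negbTE vb /Huv[//||]; last by rewrite ub.
by rewrite (linked_sym H b) vb andbF.
Qed.

Lemma comps_setU1_linked H e :
  linked H (ends e).1 (ends e).2 -> (comps H <= comps (e |: H))%N.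
Proof.
move=> he; rewrite /comps -[X in (_ <= X)%N]cardsT.
pose c := component_of (@adj (spanning (e |: H))).
apply: (@card_component_le _ _ (@adj_connect_sym (spanning H)) _ _ c) => // u v.
by move/eqP; rewrite eq_contracted_vertex linked_setU1_id.
Qed.

(** Twice the genus of the ribbon graph of [G|H], by Euler's formula; the
    number of vertices is the number of cycles of the rotation, provided that
    every vertex carries an edge. *)
Definition genus2 H : int :=
  (2 * comps H)%:Z + #|H|%:Z - #|porbits rho|%:Z - (faces H)%:Z.

(** An edge joining two components of [G|H] merges two curves and lowers the
    number of components by at most 1, so the genus does not decrease. An
    edge inside one component keeps the number of components; the genus is then
    unchanged if the edge splits a curve, and increases if it merges two. *)
Lemma genus2_setU1 H e : e \notin H ->
  genus2 H + (2 * (linked H (ends e).1 (ends e).2 && ~~ same_face H e))%:Z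
  <= genus2 (e |: H).
Proof.
move=> eH; have := faces_setU1 eH; have := comps_setU1 H e.
have := @comps_setU1_linked H e; rewrite /genus2 cardsU1 eH /=.
case: (boolP (linked _ _ _)) => [_ /(_ isT)|not_e _].
  by case: same_face => /=; lia.
have -> : same_face H e = false.
  apply/negP => /linked_walk; rewrite linked_sym; exact/negP.
by rewrite /=; lia.
Qed.

Lemma genus2S H K : H \subset K -> genus2 H <= genus2 K.
Proof.
move: {2}#|K :\: H| (erefl #|K :\: H|) => n.
elim: n H => [|n IHn] H cardKH HK.
  suff -> : H = K by [].
  by apply/eqP; rewrite eqEsubset HK -setD_eq0 -cards_eq0 cardKH.
have /card_gt0P[e] : (0 < #|K :\: H|)%N by rewrite cardKH.
rewrite inE => /andP[eH eK].
apply: le_trans (IHn (e |: H) _ _); last 2 first.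
- by move: cardKH; rewrite (cardsD1 e) inE eH eK setDDl setUC => -[].
- by rewrite subUset sub1set eK.
by apply: le_trans (genus2_setU1 eH); rewrite lerDl.
Qed.

(** Without edges the curves are the cycles of [rho], and every vertex is a
    component of its own. *)
Lemma genus2_set0 : 0 <= genus2 set0.
Proof.
have : (#|porbits rho| <= comps set0)%N.
  rewrite /comps -[X in (_ <= X)%N]cardsT.
  pose c x := component_of (@adj (spanning set0)) (endpoint x).
  apply: (@leq_trans #|c @: {: edge G * bool}|); last first.
    exact/subset_leq_card/subsetT.
  apply: card_imset_le => x y /eqP; rewrite eq_contracted_vertex.
  by move=> /linked_set0/endpointP; rewrite porbit_sym -eq_porbit_mem => /eqP.
rewrite /genus2 /faces walk_set0 cards0; lia.
Qed.

Hypothesis connG : forall u v : vert G, @linked G setT u v.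
Hypothesis euler : (#|edge G| + 2 <= #|porbits rho| + faces setT)%N.

(** The genus is squeezed between its values for [set0] and [setT], so that no
    step of the monotonicity argument can be strict. *)
Lemma genus2_eq0 H : genus2 H = 0.
Proof.
have comps1 : (comps setT <= 1)%N.
  rewrite -[X in (_ <= X)%N](cards1 tt).
  apply: (@card_component_le _ _ (@adj_connect_sym (spanning setT)) _ _
    (fun=> tt)) => //.
  - by move=> _; rewrite inE.
  - by move=> u v _; exact: connG.
have := genus2S (sub0set H); have := genus2S (subsetT H); have := genus2_set0.
have : genus2 setT <= 0 by rewrite /genus2 cardsT; lia.
lia.
Qed.

Lemma same_face_notin H e : e \notin H ->
  same_face H e = linked H (ends e).1 (ends e).2.
Proof.
move=> eH; apply/idP/idP => [/linked_walk|he]; first by rewrite linked_sym.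
have := genus2_setU1 eH; rewrite !genus2_eq0 he.
by case: same_face.
Qed.

Lemma same_face_in H e : e \in H ->
  same_face H e = ~~ linked (H :\ e) (ends e).1 (ends e).2.
Proof.
move=> eH; have eHe : e \notin H :\ e by rewrite !inE eqxx.
by rewrite -same_face_notin // -same_face_setU1 // setD1K.
Qed.

End RotationSystem.
(** * The state circles of a plane diagram *)

Lemma Z4_cases (i : 'Z_4) : [\/ i = 0, i = 1, i = 1 + 1 | i = 1 + 1 + 1].
Proof.
case: i => -[|[|[|[|]]]] //= h.
- by constructor 1; apply: val_inj.
- by constructor 2; apply: val_inj.
- by constructor 3; apply: val_inj.
- by constructor 4; apply: val_inj.
Qed.

Section Diagram.
Variables (D : link_diagram) (k : checkerboard D).
Notation corner := (crossing D * 'Z_4)%type.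
Notation end_of_edge := (crossing D * bool)%type.
Implicit Types (d : corner) (c : crossing D) (x : end_of_edge).
Let next := next_corner (@glue D).

Definition is_black d := k (region_at d).

Lemma next_corner_inj : injective next.
Proof.
move=> d d' dd'; have h1 := congr1 fst dd'; have /addIr h2 := congr1 snd dd'.
apply: (inv_inj (@glueK D)); rewrite /= in h1.
by rewrite [LHS]surjective_pairing h1 h2 -surjective_pairing.
Qed.

Lemma next_corner_sym : connect_sym (frel next).
Proof. exact/fconnect_sym/next_corner_inj. Qed.

Lemma eq_region_at d d' : (region_at d == region_at d') = fconnect next d d'.
Proof. exact/eq_component_of/next_corner_sym. Qed.

Lemma region_at_next d : region_at (next d) = region_at d.
Proof. by apply/esym/eqP; rewrite eq_region_at fconnect1. Qed.

Lemma is_black_succ c i : is_black (c, i + 1) = ~~ is_black (c, i).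
Proof. exact: blackP. Qed.

Lemma is_black_pred c i : is_black (c, i - 1) = ~~ is_black (c, i).
Proof. by rewrite -[in RHS](subrK 1 i) is_black_succ negbK. Qed.

(** The two sides of an edge of the projection have opposite colours, hence so
    do the two half-edges of that edge. *)
Lemma is_black_glue d : is_black (glue d) = ~~ is_black d.
Proof.
rewrite /is_black -[in RHS]region_at_next -!/(is_black _) is_black_pred negbK.
by rewrite -surjective_pairing.
Qed.

(** The two black corners at a crossing correspond to the two ends of its
    edge in the Tait graph. *)
Definition corner_of x : corner :=
  (x.1, black_corner k x.1 + (if x.2 then 2 else 0)).
Definition end_at d : end_of_edge := (d.1, d.2 != black_corner k d.1).

Lemma is_black_corner_of x : is_black (corner_of x).
Proof.
case: x => c [] /=; first exact: black_corner2.
by rewrite /corner_of /= addr0; exact: black_corner1.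
Qed.

Lemma corner_ofK : cancel corner_of end_at.
Proof.
case=> c b; rewrite /end_at /corner_of /=; congr (_, _).
by case: b; rewrite ?addr0 ?eqxx //; case: (Z4_cases (black_corner k c)) => ->.
Qed.

Lemma end_atK d : is_black d -> corner_of (end_at d) = d.
Proof.
case: d => c i; rewrite /corner_of /end_at /= => ci; congr (_, _).
move: ci; rewrite /black_corner -/(is_black _).
have := is_black_succ c 0; have := is_black_succ c (0 + 1).
have := is_black_succ c (0 + 1 + 1); rewrite !add0r.
case h0: (is_black (c, 0)) => /= h3 h2 h1.
all: case: (Z4_cases i) => -> //=.
all: rewrite ?h3 ?h2 ?h1 ?h0 // => _; by apply: val_inj.
Qed.

(** The cyclic order of the edges around the vertices of the Tait graph, in the
    direction opposite to [next]: this choice makes the state circles follow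
    half-edge by half-edge in [corner_of_walk]. *)
Definition rotation_fun x := end_at (glue (x.1, (corner_of x).2 + 1)).

Lemma corner_of_rotation x :
  corner_of (rotation_fun x) = glue (x.1, (corner_of x).2 + 1).
Proof.
rewrite end_atK // is_black_glue is_black_succ negbK; exact: is_black_corner_of.
Qed.

Lemma next_corner_rotation x : next (corner_of (rotation_fun x)) = corner_of x.
Proof. by rewrite corner_of_rotation /next /next_corner glueK /= addrK. Qed.

Lemma rotation_fun_inj : injective rotation_fun.
Proof.
move=> x y /(congr1 (fun z => next (corner_of z))).
by rewrite !next_corner_rotation => /(can_inj corner_ofK).
Qed.

Local Notation G := (tait_graph k).

Definition rotation : {perm (edge G * bool)} := perm rotation_fun_inj.

Lemma val_endpoint x : val (@endpoint G x) = region_at (corner_of x).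
Proof. by case: x => c [] /=; rewrite /corner_of /= ?addr0. Qed.

Lemma porbit_rotation_connect x y :
  y \in porbit rotation x -> fconnect next (corner_of x) (corner_of y).
Proof.
apply: porbit_connect => z; rewrite next_corner_sym permE.
rewrite -[X in connect _ _ X]next_corner_rotation.
exact: fconnect1.
Qed.

Lemma rotation_end_at_next d :
  is_black d -> rotation (end_at (next d)) = end_at d.
Proof.
move=> d_b; have nd_b : is_black (next d) by rewrite /is_black region_at_next.
rewrite permE /rotation_fun end_atK //= subrK -surjective_pairing.
by rewrite glueK.
Qed.

Lemma porbit_rotation_end_at d d' : is_black d -> fconnect next d d' ->
  end_at d' \in porbit rotation (end_at d).
Proof.
move=> d_b /iter_findex <-; elim: (findex _ _ _) => [|n IHn].
  exact: porbit_id.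
have dn_b : is_black (iter n next d).
  rewrite /is_black (_ : region_at _ = region_at d) //.
  by apply/esym/eqP; rewrite eq_region_at fconnect_iter.
rewrite porbit_sym /= -eq_porbit_mem.
rewrite -eq_porbit_mem in IHn; rewrite -(eqP IHn).
rewrite -(rotation_end_at_next dn_b); have /= -> // := porbit_perm rotation 1.
Qed.

Lemma endpoint_rotationP x y :
  reflect (@endpoint G x = endpoint y) (y \in porbit rotation x).
Proof.
apply: (iffP idP) => [/porbit_rotation_connect|/(congr1 val)/eqP].
  rewrite -eq_region_at => /eqP xy; apply: val_inj.
  by rewrite [LHS]val_endpoint xy -val_endpoint.
rewrite [X in X == _]val_endpoint [X in _ == X]val_endpoint eq_region_at.
move/(porbit_rotation_end_at (is_black_corner_of x)).
by rewrite !corner_ofK.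
Qed.

Lemma corner_of_opposite c b :
  black_corner k c + (if ~~ b then 2 else 0) + 1
  = black_corner k c + (if b then 2 else 0) - 1.
Proof. by rewrite -!addrA; congr (_ + _); case: b; apply: val_inj. Qed.

(** Crossing every edge before turning around the black region leads around
    a white region. *)
Definition white_corner x : corner := (x.1, (corner_of x).2 - 1).

Lemma next_white_corner x :
  next (white_corner x) = white_corner (walk rotation setT x).
Proof.
rewrite walkE permE /white_corner corner_of_rotation /next /next_corner.
case: x => c b; rewrite /flip_fun /= !inE addbT.
by rewrite corner_of_opposite.
Qed.

(** The cycles of [rotation] are the black regions, those of
    [walk rotation setT] are the white ones. *)
Lemma card_region_le :
  (#|region D| <= #|porbits rotation| + #|porbits (walk rotation setT)|)%N.
Proof.
pose f d : {set end_of_edge} + {set end_of_edge} :=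
  if is_black d then inl (porbit rotation (end_at d))
  else inr (porbit (walk rotation setT) (end_at (d.1, d.2 + 1))).
pose A := inl @: porbits rotation :|: inr @: porbits (walk rotation setT).
apply: (@leq_trans #|A|); last first.
  rewrite cardsU; apply: leq_trans (leq_subr _ _) _.
  by rewrite leq_add ?leq_imset_card.
apply: (@card_component_le _ _ next_corner_sym _ A f) => [d|d d'].
  by rewrite /f !inE; case: ifP => _; rewrite !imset_f ?orbT.
rewrite /f; case: ifPn => d_b; case: ifPn => d'_b // [] /eqP.
  rewrite eq_porbit_mem porbit_sym => /porbit_rotation_connect.
  by rewrite !end_atK.
have wK d0 : ~~ is_black d0 -> white_corner (end_at (d0.1, d0.2 + 1)) = d0.
  move=> d0_w; rewrite /white_corner.
  rewrite end_atK ?is_black_succ -?surjective_pairing //=.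
  by rewrite addrK -surjective_pairing.
rewrite eq_porbit_mem porbit_sym => ww.
rewrite -(wK d d_b) -(wK d' d'_b).
apply: porbit_connect ww => x.
by rewrite -next_white_corner; exact: fconnect1.
Qed.

(** An edge of the projection has exactly one black half-edge, so distinct
    black corners give distinct edges. *)
Lemma card_component_glue :
  (#|crossing D| * 2 <= #|component (frel (@glue D))|)%N.
Proof.
pose f x := component_of (frel (@glue D)) (corner_of x).
have <- : #|{: end_of_edge}| = (#|crossing D| * 2)%N.
  by rewrite card_prod card_bool.
apply: (@leq_card _ _ f) => x y /eqP.
rewrite eq_component_of; last exact/fconnect_sym/inv_inj/glueK.
move=> xy.
suff [] : corner_of y = corner_of x \/ corner_of y = glue (corner_of x).
- by move/(can_inj corner_ofK).
- move/(congr1 is_black); rewrite is_black_glue !is_black_corner_of //.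
rewrite -(iter_findex xy); elim: (findex _ _ _) => [|n] /=; first by left.
by case=> ->; [right | left; rewrite glueK].
Qed.

Lemma euler_faces : (0 < #|crossing D|)%N ->
  (#|edge G| + 2 <= #|porbits rotation| + faces rotation setT)%N.
Proof.
case/card_gt0P=> c _.
have : (0 < #|component (crossing_adj (@glue D))|)%N.
  by apply/card_gt0P; exists (component_of _ c).
have := planar D; rewrite /euler_planar; have := card_component_glue.
by have := card_region_le; rewrite /region /faces /=; lia.
Qed.

(** One of the two regions along an edge of the projection is black and meets
    the crossings at both ends of that edge. *)
Lemma linked_crossings c c' b b' : connect (crossing_adj (@glue D)) c c' ->
  linked setT (@endpoint G (c, b)) (@endpoint G (c', b')).
Proof.
have same_crossing c0 (b0 b1 : bool) :
    linked setT (@endpoint G (c0, b0)) (@endpoint G (c0, b1)).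
  have h := @linked_ends G setT c0 (in_setT _).
  by case: b0; case: b1; rewrite /endpoint /= -?/(linked _ _ _) //;
    rewrite ?[linked _ _ _]connect0 // linked_sym.
have same_region d d' : is_black d -> is_black d' ->
      region_at d = region_at d' ->
    linked setT (@endpoint G (end_at d)) (@endpoint G (end_at d')).
  move=> d_b d'_b dd'; rewrite [linked _ _ _]eq_connect0 //.
  apply: val_inj; rewrite [LHS]val_endpoint [RHS]val_endpoint.
  by rewrite !end_atK.
case/connectP => p; elim: p c b => [|c1 p IHp] c b /=.
  by move=> _ ->.
case/andP=> /existsP[i /existsP[j /eqP glue_ci]] c1p c'E.
apply: linked_trans (IHp c1 b' c1p c'E).
have glue_cj : glue (c1, j) = (c, i) by rewrite -glue_ci glueK.
have [ci_b|ci_w] := boolP (is_black (c, i)).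
  have := same_region (c, i) (next (c, i)).
  rewrite /is_black region_at_next => /(_ ci_b ci_b erefl).
  rewrite /next /next_corner glue_ci /end_at /= => h.
  by apply: linked_trans (same_crossing _ _ _)
    (linked_trans h (same_crossing _ _ _)).
have cj_b : is_black (c1, j) by rewrite -glue_ci is_black_glue.
have := same_region (next (c1, j)) (c1, j).
rewrite /is_black region_at_next => /(_ cj_b cj_b erefl).
rewrite /next /next_corner glue_cj /end_at /= => h.
by apply: linked_trans (same_crossing _ _ _)
    (linked_trans h (same_crossing _ _ _)).
Qed.

Lemma tait_graph_connected :
  connected D -> forall u v : vert G, linked setT u v.
Proof.
move=> connD.
have vertE (u : vert G) : exists x, u = @endpoint G x.
  have /eqP uE := xchooseP (component_ofP (val u)).
  set d := xchoose _ in uE.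
  have d_b : is_black d by rewrite /is_black /region_at -uE; exact: (valP u).
  exists (end_at d); apply: val_inj.
  by rewrite [RHS]val_endpoint end_atK.
move=> u v; have [[c b] ->] := vertE u; have [[c' b'] ->] := vertE v.
exact/linked_crossings/connD.
Qed.

Section State.
Variable s : state D.
Let E := E_state k s.
Let W := walk rotation E.

(** The crossing is in [E] when its smoothing joins the black corners; the arc
    then cuts off the white corner on the right of the half-edge [i], and
    otherwise the black corner on its left. *)
Lemma smoothing_black c i : is_black (c, i) ->
  smoothing_arc (s c) i = if c \in E then i - 1 else i + 1.
Proof.
rewrite /E inE /positive_edge /negative_edge /joins_black.
rewrite -!/(is_black _) /smoothing_arc.
have := is_black_succ c 0; have := is_black_succ c (0 + 1).
have := is_black_succ c (0 + 1 + 1); rewrite !add0r.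
case h0: (is_black (c, 0)) => /= h3 h2 h1.
all: by case: (Z4_cases i) => ->; case: (s c) => /=; rewrite ?h3 ?h2 ?h1 ?h0.
Qed.

Lemma smoothing_arcK r : involutive (smoothing_arc r).
Proof.
by move=> i; case: r; case: (Z4_cases i) => ->; exact: val_inj.
Qed.

Lemma is_black_smoothing c i :
  is_black (c, smoothing_arc (s c) i) = ~~ is_black (c, i).
Proof.
by rewrite /smoothing_arc; case: ifP => _;
  rewrite ?is_black_succ ?is_black_pred.
Qed.

Lemma circle_rel_sym : connect_sym (circle_rel s).
Proof.
apply: sym_connect_sym => d d'; rewrite /circle_rel; congr (_ || _).
  by apply/eqP/eqP => ->; rewrite glueK.
by apply/eqP/eqP => -> /=; rewrite smoothing_arcK -surjective_pairing.
Qed.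

Definition smooth d : corner := (d.1, smoothing_arc (s d.1) d.2).

Lemma smoothK : involutive smooth.
Proof. by case=> c i; rewrite /smooth /= smoothing_arcK. Qed.

(** One step of the walk follows the smoothing arc, then the next edge of the
    projection. *)
Lemma corner_of_walk x :
  corner_of (W x) = glue (smooth (corner_of x)).
Proof.
rewrite walkE permE corner_of_rotation; congr glue; congr (_, _).
rewrite smoothing_black; last exact: is_black_corner_of.
case: x => c b; rewrite /flip_fun /=; case: (c \in E); last by rewrite addbF.
by rewrite addbT corner_of_opposite.
Qed.

(** Half-edges alternate between black and white along a state circle; a circle
    is thus the cycle of its black half-edges. *)
Definition black_end d := end_at (if is_black d then d else smooth d).

Lemma black_end_smooth d : black_end (smooth d) = black_end d.
Proof.
rewrite /black_end smoothK; case: d => c i; rewrite is_black_smoothing /=.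
by case: (is_black _).
Qed.

Lemma black_end_glue d : ~~ is_black d -> black_end (glue d) = W (black_end d).
Proof.
move=> d_w; rewrite /black_end is_black_glue d_w (negbTE d_w).
apply: (can_inj corner_ofK); rewrite corner_of_walk !end_atK ?smoothK //.
  by case: d d_w => c i d_w; rewrite is_black_smoothing.
by rewrite is_black_glue.
Qed.

Lemma circle_walk d d' :
  connect (circle_rel s) d d' = (black_end d' \in porbit W (black_end d)).
Proof.
have bE d0 : is_black (if is_black d0 then d0 else smooth d0).
  by case: ifPn => //; case: d0 => c i; rewrite is_black_smoothing.
apply/idP/idP.
  case/connectP => p; elim: p d => [|d1 p IHp] d /=.
    by move=> _ ->; exact: porbit_id.
  case/andP=> dd1 /IHp h /h; rewrite -!eq_porbit_mem => /eqP ->; apply/eqP.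
  have porbit_walk x : porbit W (W x) = porbit W x := porbit_perm W 1 x.
  have [d_b|d_w] := boolP (is_black d); last first.
    case/orP: dd1 => /eqP ->; first by rewrite black_end_glue // porbit_walk.
    by rewrite black_end_smooth.
  case/orP: dd1 => /eqP ->; rewrite ?black_end_smooth //.
  have := @black_end_glue (glue d); rewrite is_black_glue d_b glueK => -> //.
have back d0 : connect (circle_rel s) d0 (corner_of (black_end d0)).
  rewrite end_atK //; case: ifP => _; first exact: connect0.
  by apply: connect1; rewrite /circle_rel eqxx orbT.
move=> dd'; apply: connect_trans (back d) _.
rewrite circle_rel_sym; apply: connect_trans (back d') _.
rewrite circle_rel_sym.
apply: porbit_connect dd' => x; rewrite corner_of_walk.
apply: (@connect_trans _ _ (smooth (corner_of x))); apply: connect1.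
  by rewrite /circle_rel eqxx orbT.
by rewrite /circle_rel eqxx.
Qed.

Lemma state_segment_loop c :
  is_loop (c : edge (state_graph s)) = same_face rotation E c.
Proof.
rewrite /is_loop /= eq_component_of; last exact: circle_rel_sym.
rewrite circle_walk /same_face -/W /black_end.
have := is_black_succ c 0; have := is_black_succ c (0 + 1); rewrite !add0r.
have bc : black_corner k c = if is_black (c, 0) then 0 else 1 by [].
rewrite (_ : 2 = 1 + 1) // /end_at.
case h0: (is_black (c, 0)) bc => /= bc h2 h1; rewrite h2 h1 /= bc.
  by rewrite porbit_sym.
by case: (s c); rewrite // porbit_sym.
Qed.

End State.

End Diagram.

Theorem theorem1p2 (D : link_diagram) (k : checkerboard D) (s : state D)
  (hconn : connected D) (hcross : (0 < #|crossing D|)%N) :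
  adequate s <-> phi k s <> 0.
Proof.
set G := tait_graph k; set E := E_state k s.
have segment (c : edge G) : is_loop (c : edge (state_graph s)) =
    if c \in E then ~~ linked (E :\ c) (ends c).1 (ends c).2
    else linked E (ends c).1 (ends c).2.
  have conn := tait_graph_connected (k := k) hconn.
  have euler := euler_faces k hcross; have endP := endpoint_rotationP (k := k).
  rewrite (state_segment_loop k); case: ifPn => cE; first exact: same_face_in.
  exact: same_face_notin.
have -> : phi k s <> 0 <-> bridgeless (spanning E) /\ loopless (contract E).
  rewrite -tutte_0X_neq0 -tutte_X0_neq0; split=> [/eqP|[h1 h2]]; last apply/eqP;
    rewrite /phi -/G -/E mulf_eq0 negb_or; [by move/andP | by rewrite h1].
split=> [ad|[E_nb E_nl] c].
  split=> c; last first.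
    rewrite is_loop_contract; have := ad (val c); rewrite segment.
    by have := valP c; rewrite inE => /negbTE ->.
  rewrite is_bridge_spanning; have := ad (val c); rewrite segment.
  by have := valP c => /= ->.
rewrite segment; case: ifPn => cE.
  by have := E_nb (exist _ c cE); rewrite is_bridge_spanning.
have cE' : c \in ~: E by rewrite inE.
by have := E_nl (exist _ c cE'); rewrite is_loop_contract.
Qed.
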